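(* Let $S$ be a $\Gamma$-semiring which has a left unity and a right unity, and let $L$ be its left operator semiring. For a fuzzy subset $\sigma$ of $S$ let $\sigma^{+'}$ be the fuzzy subset of $L$ defined by $\sigma^{+'}(\sum_i[x_i,\alpha_i])=\inf_{a\in S}\sigma(\sum_i x_i\alpha_i a)$ for $\sum_i[x_i,\alpha_i]\in L$. Then: (1) if $\sigma$ is a fuzzy left ideal of $S$, then $\sigma^{+'}$ is a fuzzy left ideal of $L$; (2) if $\sigma$ is a fuzzy right ideal of $S$, then $\sigma^{+'}$ is a fuzzy right ideal of $L$; (3) if $\sigma$ is a fuzzy ideal of $S$, then $\sigma^{+'}$ is a fuzzy ideal of $L$.
   Context: $\Gamma$-semiring: $S$ and $\Gamma$ are (nonempty) additive commutative semigroups with a map $S\times\Gamma\times S\to S$, $(a,\alpha,b)\mapsto a\alpha b$, such that $a\alpha(b+c)=a\alpha b+a\alpha c$, $(a+b)\alpha c=a\alpha c+b\alpha c$, $a(\alpha+\beta)c=a\alpha c+a\beta c$, $a\alpha(b\beta c)=(a\alpha b)\beta c$ for all $a,b,c\in S$, $\alpha,\beta\in\Gamma$. No zero elements are assumed. Left operator semiring $L$: let $F$ be the free additive commutative semigroup generated by $S\times\Gamma$ (finite nonempty formal sums). The relation $\sum_i(x_i,\alpha_i)\,\rho\,\sum_j(y_j,\beta_j)$ iff $\sum_i x_i\alpha_i a=\sum_j y_j\beta_j a$ for all $a\in S$ is a congruence on $F$. The class of $\sum_i(x_i,\alpha_i)$ is written $\sum_i[x_i,\alpha_i]$. $L=F/\rho$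 with the induced addition and the multiplication $(\sum_i[x_i,\alpha_i])(\sum_j[y_j,\beta_j])=\sum_{i,j}[x_i\alpha_i y_j,\beta_j]$ is a semiring. Unities: a left unity of $S$ is a finite sum $\sum_i[e_i,\delta_i]\in L$ with $\sum_i e_i\delta_i a=a$ for all $a\in S$. A right unity of $S$ is given by finitely many $\gamma_j\in\Gamma$, $f_j\in S$ with $\sum_j a\gamma_j f_j=a$ for all $a\in S$. A fuzzy subset of a set $X$ is a function $X\to[0,1]$. A fuzzy subset $\mu$ of $S$ is a fuzzy left (respectively right) ideal of $S$ if for all $a,b\in S$, $\alpha\in\Gamma$: $\mu(a+b)\ge\min(\mu(a),\mu(b))$ and $\mu(a\alpha b)\ge\mu(b)$ (respectively $\mu(a\alpha b)\ge\mu(a)$). A fuzzy subset $\mu$ of $L$ is a fuzzy left (respectively right) ideal of $L$ if for all $p,q\in L$: $\mu(p+q)\ge\min(\mu(p),\mu(q))$ and $\mu(pq)\ge\mu(q)$ (respectively $\mu(pq)\ge\mu(p)$). A fuzzy ideal (of $S$ or of $L$) is a fuzzy subset that is both a fuzzy left ideal and a fuzzy right ideal. *)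

(* Defs.v *)
From HB Require Import structures.
From mathcomp Require Import all_boot all_order all_algebra.
From mathcomp Require Import generic_quotient.
From mathcomp Require Import finmap multiset.
From mathcomp Require Import boolp classical_sets reals interval_inference.

Set Implicit Arguments.
Unset Strict Implicit.
Unset Printing Implicit Defensive.
Import Order.TTheory GRing.Theory Num.Theory.

Local Open Scope ring_scope.
Local Open Scope quotient_scope.

(* In MathComp an addSemigroupType is a COMMUTATIVE additive semigroup; it has
   no distinguished zero, so \sum is not available. *)

Section NonemptySum.
Variable V : addSemigroupType.
Implicit Types s t : seq V.

Definition nesum s : s != [::] -> V :=
  match s with
  | [::] => fun h => False_rect V (notF h)
  | x :: s' => fun _ => foldl +%R x s'
  end.

Lemma nesum_oAC s (h : s != [::]) :
  Some (nesum h) =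
  \big[oAC (@Algebra.addrA V) (@Algebra.addrC V)/None]_(x <- s) Some x.
Proof.
case: s h => // x s _ /=; elim/last_ind: s => [|s y IH] /=.
  by rewrite big_seq1.
by rewrite -cats1 foldl_cat /= -cat_cons big_cat big_seq1 -IH.
Qed.

Lemma perm_nesum s t (hs : s != [::]) (ht : t != [::]) :
  perm_eq s t -> nesum hs = nesum ht.
Proof.
by move=> st; apply: Some_inj; rewrite !nesum_oAC; apply: perm_big.
Qed.

Lemma nesum_cat s t (hs : s != [::]) (ht : t != [::]) (hst : s ++ t != [::]) :
  nesum hst = nesum hs + nesum ht.
Proof. by apply: Some_inj; rewrite nesum_oAC big_cat -!nesum_oAC. Qed.

End NonemptySum.

Lemma map_neq0 (T U : eqType) (f : T -> U) (s : seq T) :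
  (map f s != [::]) = (s != [::]).
Proof. by case: s. Qed.

Lemma raddf_nesum (V W : addSemigroupType) (f : V -> W)
    (fD : {morph f : x y / x + y}) (s : seq V)
    (hs : s != [::]) (hfs : map f s != [::]) :
  f (nesum hs) = nesum hfs.
Proof.
case: s hs hfs => // x s _ _ /=; elim: s x => //= y s IH x.
by rewrite IH fD.
Qed.

(* The free commutative semigroup on A: formal sums are the nonempty finite
   multisets of elements of A. *)
Section FreeSemigroup.
Variable A : choiceType.

Definition freeSG : Type := {m : {mset A}%mset | m != mset0}.
HB.instance Definition _ := Choice.on freeSG.

Lemma seq_mset_neq0 (s : seq A) : (seq_mset s != mset0) = (s != [::]).
Proof.
congr negb; apply/eqP/eqP => [|->]; last first.
  by apply/msetP => x; rewrite mset_seqE mset0E.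
case: s => // x s /msetP /(_ x).
by rewrite mset_seqE mset0E /= eqxx.
Qed.

Lemma enum_freeSG_neq0 (m : freeSG) : (val m : seq A) != [::].
Proof. by rewrite -seq_mset_neq0 seq_mset_id; exact: (valP m). Qed.

Definition freeSG_of_seq (s : seq A) (h : s != [::]) : freeSG :=
  exist _ (seq_mset s) (etrans (seq_mset_neq0 s) h).

Lemma perm_freeSG_of_seq (s : seq A) (h : s != [::]) :
  perm_eq (val (freeSG_of_seq h)) s.
Proof. exact: perm_eq_seq_mset. Qed.

Definition freeSG_gen (x : A) : freeSG := @freeSG_of_seq [:: x] isT.

Lemma freeSG_add_subproof (m n : freeSG) : msetD (val m) (val n) != mset0.
Proof.
case: m n => [m /= hm] [n hn] /=; apply: contra hm => /eqP /msetP e.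
apply/eqP/msetP => x; move: (e x); rewrite msetE2 mset0E => /eqP.
by rewrite addn_eq0 => /andP[/eqP].
Qed.

Definition freeSG_add (m n : freeSG) : freeSG :=
  exist _ (msetD (val m) (val n)) (freeSG_add_subproof m n).

Lemma freeSG_addC : commutative freeSG_add.
Proof.
by move=> m n; apply/val_inj/msetP => x /=; rewrite !msetE2 addnC.
Qed.

Lemma freeSG_addA : associative freeSG_add.
Proof.
by move=> m n p; apply/val_inj/msetP => x /=; rewrite !msetE2 addnA.
Qed.

HB.instance Definition _ := Algebra.isAddSemigroup.Build
  freeSG freeSG_addC freeSG_addA.

Lemma perm_freeSG_add (m n : freeSG) :
  perm_eq (val (m + n)) (val m ++ val n : seq A).
Proof.
by apply/allP => x _; rewrite /= count_cat !count_mem_mset msetE2.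
Qed.

Section Lift.
Variables (V : addSemigroupType) (f : A -> V).

Lemma map_freeSG_neq0 (m : freeSG) : map f (val m) != [::].
Proof. by rewrite map_neq0 enum_freeSG_neq0. Qed.

(* The sum of f x over the terms x of the formal sum m. *)
Definition fsum (m : freeSG) : V := nesum (map_freeSG_neq0 m).

Lemma fsumD (m n : freeSG) : fsum (m + n) = fsum m + fsum n.
Proof.
have h : map f (val m) ++ map f (val n) != [::].
  by move: (map_freeSG_neq0 m); case: (map f _).
rewrite /fsum -(nesum_cat _ _ h); apply: perm_nesum.
by rewrite -map_cat; apply: perm_map; apply: perm_freeSG_add.
Qed.

Lemma fsum_of_seq (s : seq A) (h : s != [::]) (h' : map f s != [::]) :
  fsum (freeSG_of_seq h) = nesum h'.
Proof. exact/perm_nesum/perm_map/perm_freeSG_of_seq. Qed.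

Lemma fsum_gen x : fsum (freeSG_gen x) = f x.
Proof. exact: (@fsum_of_seq [:: x] isT isT). Qed.

End Lift.

Lemma eq_fsum (V : addSemigroupType) (f g : A -> V) : f =1 g -> fsum f =1 fsum g.
Proof.
by move=> fg m; apply: perm_nesum; rewrite (eq_map fg) perm_refl.
Qed.

Lemma raddf_fsum (V W : addSemigroupType) (h : V -> W)
    (hD : {morph h : x y / x + y}) (f : A -> V) (m : freeSG) :
  h (fsum f m) = fsum (h \o f) m.
Proof.
have e : map h (map f (val m)) != [::] by rewrite map_neq0 map_freeSG_neq0.
by rewrite (raddf_nesum hD _ e); apply: perm_nesum; rewrite map_comp perm_refl.
Qed.

End FreeSemigroup.

Record gammaSemiring (S G : addSemigroupType) := GammaSemiring {
  gmul : S -> G -> S -> S;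
  gS_inhabited : inhabited S;
  gG_inhabited : inhabited G;
  gmulDr : forall a x b c, gmul a x (b + c) = gmul a x b + gmul a x c;
  gmulDl : forall a b x c, gmul (a + b) x c = gmul a x c + gmul b x c;
  gmulDm : forall a x y c, gmul a (x + y) c = gmul a x c + gmul a y c;
  gmulA : forall a x b y c, gmul a x (gmul b y c) = gmul (gmul a x b) y c
}.

(* A semiring here may have neither a zero nor a one, so pzSemiRingType is
   too strong. *)
Record semiringOn (T : addSemigroupType) := SemiringOn {
  smul : T -> T -> T;
  smulA : associative smul;
  smulDl : left_distributive smul +%R;
  smulDr : right_distributive smul +%R
}.

Section LeftOperatorSemiring.
Variables (S G : addSemigroupType) (M : gammaSemiring S G).

Local Notation F := (freeSG (S * G)%type).

(* \sum_i x_i alpha_i a for the formal sum m = \sum_i (x_i, alpha_i) *)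
Definition feval (m : F) (a : S) : S := fsum (fun p => gmul M p.1 p.2 a) m.

Lemma fevalD (m n : F) a : feval (m + n) a = feval m a + feval n a.
Proof. exact: fsumD. Qed.

Lemma feval_addr (m : F) a b : feval m (a + b) = feval m a + feval m b.
Proof.
rewrite /feval /fsum.
have := map_freeSG_neq0 (fun p => gmul M p.1 p.2 a) m.
move: (map_freeSG_neq0 _ m) (map_freeSG_neq0 _ m) (map_freeSG_neq0 _ m).
move: (EnumMset.f _) => [|p s] //= _ _ _ _.
elim/last_ind: s => [|s q IH] /=; first exact: gmulDr.
by rewrite !map_rcons -!cats1 !foldl_cat /= IH gmulDr Algebra.addrACA.
Qed.

Definition rho : rel F := fun m n => `[< forall a, feval m a = feval n a >].

Lemma rhoP m n : reflect (forall a, feval m a = feval n a) (rho m n).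
Proof. exact: asboolP. Qed.

Lemma rho_refl : reflexive rho.
Proof. by move=> m; apply/rhoP. Qed.

Lemma rho_sym : symmetric rho.
Proof. by move=> m n; apply/rhoP/rhoP => e a; rewrite e. Qed.

Lemma rho_trans : transitive rho.
Proof. by move=> n m p /rhoP e1 /rhoP e2; apply/rhoP => a; rewrite e1. Qed.

Canonical rho_equiv := EquivRel rho rho_refl rho_sym rho_trans.

Definition leftOp : Type := {eq_quot rho}.
HB.instance Definition _ := Choice.on leftOp.
HB.instance Definition _ := EqQuotient.on leftOp.
Implicit Types p q r : leftOp.

(* The class of the formal sum m, i.e. \sum_i [x_i, alpha_i]. *)
Definition lclass (m : F) : leftOp := \pi m.

(* \sum_i x_i alpha_i a for the class p = \sum_i [x_i, alpha_i]; this does not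
   depend on the representative by lact_class. *)
Definition lact p (a : S) : S := feval (repr p) a.

Lemma lact_class m a : lact (lclass m) a = feval m a.
Proof.
suff /eqmodP/rhoP : repr (lclass m) = m %[mod leftOp] by apply.
by rewrite reprK.
Qed.

Lemma lact_inj p q : lact p =1 lact q -> p = q.
Proof.
move=> e; rewrite -[p]reprK -[q]reprK; apply/eqmodP/rhoP; exact: e.
Qed.

Lemma lclassP m n : reflect (lclass m = lclass n) (rho m n).
Proof. exact: (@eqmodP _ rho_equiv m n). Qed.

Definition ladd p q : leftOp := lclass (repr p + repr q).

Lemma lact_add p q a : lact (ladd p q) a = lact p a + lact q a.
Proof. by rewrite lact_class fevalD. Qed.

Lemma laddC : commutative ladd.
Proof.
by move=> p q; apply: lact_inj => a; rewrite !lact_add Algebra.addrC.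
Qed.

Lemma laddA : associative ladd.
Proof.
by move=> p q r; apply: lact_inj => a; rewrite !lact_add Algebra.addrA.
Qed.

HB.instance Definition _ := Algebra.isAddSemigroup.Build leftOp laddC laddA.

Lemma lactD p q a : lact (p + q) a = lact p a + lact q a.
Proof. exact: lact_add. Qed.

Lemma lclassD m n : lclass (m + n) = lclass m + lclass n.
Proof. by apply: lact_inj => a; rewrite lactD !lact_class fevalD. Qed.

Lemma fmul_subproof (m n : F) :
  [seq (gmul M x.1 x.2 y.1, y.2) | x <- val m, y <- val n] != [::].
Proof.
move: (enum_freeSG_neq0 m) (enum_freeSG_neq0 n).
by move: (EnumMset.f _) (EnumMset.f _) => [|x s] // [|y t].
Qed.

(* \sum_(i, j) (x_i alpha_i y_j, beta_j) *)
Definition fmul (m n : F) : F := freeSG_of_seq (fmul_subproof m n).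

Lemma feval_mul m n a : feval (fmul m n) a = feval m (feval n a).
Proof.
have -> : feval m (feval n a) =
    fsum (fun x => fsum (fun y => gmul M (gmul M x.1 x.2 y.1) y.2 a) n) m.
  apply: eq_fsum => x; rewrite /feval (raddf_fsum (gmulDr M x.1 x.2)).
  by apply: eq_fsum => y /=; rewrite gmulA.
rewrite /feval fsum_of_seq => [|h].
  by rewrite map_neq0 fmul_subproof.
apply: Some_inj; rewrite !nesum_oAC !big_map big_allpairs_dep.
by apply: eq_bigr => x _; rewrite nesum_oAC big_map.
Qed.

Definition lmul p q : leftOp := lclass (fmul (repr p) (repr q)).

Lemma lact_mul p q a : lact (lmul p q) a = lact p (lact q a).
Proof. by rewrite lact_class feval_mul. Qed.

Lemma lclassM m n : lclass (fmul m n) = lmul (lclass m) (lclass n).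
Proof.
by apply: lact_inj => a; rewrite lact_mul !lact_class feval_mul.
Qed.

Lemma lmulA : associative lmul.
Proof. by move=> p q r; apply: lact_inj => a; rewrite !lact_mul. Qed.

Lemma lmulDl : left_distributive lmul +%R.
Proof.
by move=> p q r; apply: lact_inj => a; rewrite lactD !lact_mul lactD.
Qed.

Lemma lmulDr : right_distributive lmul +%R.
Proof.
move=> p q r; apply: lact_inj => a.
by rewrite lactD !lact_mul lactD [LHS]feval_addr.
Qed.

Definition leftOp_semiring : semiringOn leftOp := SemiringOn lmulA lmulDl lmulDr.

(* The action of L on S sends \sum_i [e_i, delta_i] to the map
   a |-> \sum_i e_i delta_i a. *)
Definition has_left_unity : Prop :=
  exists e : leftOp, forall a, lact e a = a.

Definition has_right_unity : Prop :=
  exists m : freeSG (G * S)%type, forall a,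
    fsum (fun u : G * S => gmul M a u.1 u.2) m = a.

End LeftOperatorSemiring.

Section FuzzyIdeals.
Variable R : realType.

(* Fuzzy subsets of X are functions X -> {i01 R}, where {i01 R} is [0, 1]. *)

Section OnGammaSemiring.
Variables (S G : addSemigroupType) (M : gammaSemiring S G) (mu : S -> {i01 R}).

Definition fuzzy_left_ideal : Prop :=
  (forall a b, mu (a + b) >= Num.min (mu a) (mu b)) /\
  (forall a x b, mu (gmul M a x b) >= mu b).

Definition fuzzy_right_ideal : Prop :=
  (forall a b, mu (a + b) >= Num.min (mu a) (mu b)) /\
  (forall a x b, mu (gmul M a x b) >= mu a).

Definition fuzzy_ideal : Prop := fuzzy_left_ideal /\ fuzzy_right_ideal.

End OnGammaSemiring.

Section OnSemiring.
Variables (T : addSemigroupType) (L : semiringOn T) (mu : T -> {i01 R}).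

Definition sr_fuzzy_left_ideal : Prop :=
  (forall p q, mu (p + q) >= Num.min (mu p) (mu q)) /\
  (forall p q, mu (smul L p q) >= mu q).

Definition sr_fuzzy_right_ideal : Prop :=
  (forall p q, mu (p + q) >= Num.min (mu p) (mu q)) /\
  (forall p q, mu (smul L p q) >= mu p).

Definition sr_fuzzy_ideal : Prop := sr_fuzzy_left_ideal /\ sr_fuzzy_right_ideal.

End OnSemiring.

Section Infimum.
Local Open Scope classical_set_scope.
Variables (X : Type) (f : X -> {i01 R}).

Lemma inf01_ge0 : 0 <= inf [set (f x)%:num | x in [set: X]].
Proof.
set E := (X in inf X).
have [[x]|nE] := pselect (inhabited X).
  by apply: lb_le_inf => [|z [y _ <-] //]; exists (f x)%:num, x.
suff -> : E = set0 by rewrite inf0.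
by rewrite -subset0 => y [x _ _]; case: nE; exists.
Qed.

Lemma inf01_le1 : inf [set (f x)%:num | x in [set: X]] <= 1.
Proof.
set E := (X in inf X).
have [[x]|nE] := pselect (inhabited X).
  apply: (@le_trans _ _ (f x)%:num) => //; apply: ge_inf; last by exists x.
  by exists 0 => z [y _ <-].
suff -> : E = set0 by rewrite inf0.
by rewrite -subset0 => y [x _ _]; case: nE; exists.
Qed.

(* The infimum of f over X, as an element of [0, 1]; the library value
   inf set0 = 0 never matters, X being the carrier of a Gamma-semiring. *)
Definition inf01 : {i01 R} := Itv01 inf01_ge0 inf01_le1.

End Infimum.

Definition sigma_plus (S G : addSemigroupType) (M : gammaSemiring S G)
    (sigma : S -> {i01 R}) : leftOp M -> {i01 R} :=
  fun p => inf01 (fun a : S => sigma (lact p a)).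

Lemma sigma_plusE (S G : addSemigroupType) (M : gammaSemiring S G)
    (sigma : S -> {i01 R}) (m : freeSG (S * G)%type) :
  (sigma_plus sigma (lclass M m))%:num =
  inf [set (sigma (feval M m a))%:num | a in [set: S]]%classic.
Proof.
rewrite /=; congr (inf _); apply: eq_imagel => a _.
by rewrite lact_class.
Qed.

End FuzzyIdeals.

Arguments sigma_plus {R S G} M sigma p.

(* Main.v *)
Require Import Defs.
From mathcomp Require Import all_boot all_order all_algebra.
From mathcomp Require Import finmap multiset.
From mathcomp Require Import boolp classical_sets reals interval_inference.

Set Implicit Arguments.
Unset Strict Implicit.
Unset Printing Implicit Defensive.
Import Order.TTheory GRing.Theory Num.Theory.

Local Open Scope ring_scope.

(** An element of L acts on S through [lact]: a sum acts pointwise and a product by composition, so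
    the value at [p q] is the infimum of [sigma (p (q a))] over [a]. For a left ideal, acting by [p]
    never lowers [sigma] ([fuzzy_left_ideal_lact]), so each term is at least [sigma (q a)], hence at
    least the value at [q]. For a right ideal, each term is already among those whose infimum is the
    value at [p]. Sums follow termwise ([sigma_plusD]). *)

Section Infimum.
Variables (R : realType) (X : Type) (f : X -> {i01 R}).

Lemma inf01_le x : inf01 f <= f x.
Proof.
rewrite -num_le; apply: ge_inf; last by exists x.
by exists 0 => _ [y _ <-].
Qed.

(** Over an empty [X] the infimum takes the default value 0, and the bound would fail for positive
    [c]. *)
Lemma le_inf01 c : inhabited X -> (forall x, c <= f x) -> c <= inf01 f.
Proof.
move=> [x0] cf; rewrite -num_le; apply: lb_le_inf.
  by exists (f x0)%:num, x0.
by move=> _ [y _ <-]; rewrite num_le.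
Qed.

End Infimum.

(** Formal sums are nonempty, so the induction starts at a first term and [P] needs no zero case. *)
Lemma fsum_closed (A : choiceType) (V : addSemigroupType) (f : A -> V)
    (P : V -> Prop) (m : freeSG A) :
  (forall u v, P u -> P v -> P (u + v)) -> (forall x, P (f x)) -> P (fsum f m).
Proof.
move=> PD Pf; rewrite /fsum; move: (map_freeSG_neq0 f m).
case: (EnumMset.f _) => //= x s _; move: (Pf x).
(* The partial sum accumulated by [foldl] is generalised, keeping only that it satisfies [P]. *)
by elim: s (f x) => //= y s IH v Pv; apply/IH/PD.
Qed.

Section SigmaPlus.
Variables (R : realType) (S G : addSemigroupType) (M : gammaSemiring S G).
Variable sigma : S -> {i01 R}.

Lemma fuzzy_left_ideal_lact (p : leftOp M) a :
  fuzzy_left_ideal M sigma -> sigma a <= sigma (lact p a).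
Proof.
(* The upper level set of [sigma] at height [sigma a] is closed under sums and contains every
   [gmul M x alpha a]. *)
move=> [sD sM]; apply: (fsum_closed (P := fun b => sigma a <= sigma b)) => //.
by move=> u v au av; apply: le_trans (sD u v); rewrite le_min au.
Qed.

Lemma sigma_plusD :
  (forall a b, sigma (a + b) >= Num.min (sigma a) (sigma b)) ->
  forall p q : leftOp M, sigma_plus M sigma (p + q) >=
    Num.min (sigma_plus M sigma p) (sigma_plus M sigma q).
Proof.
move=> sD p q; apply: le_inf01 => [|a]; first exact: gS_inhabited M.
rewrite lactD; apply: le_trans (sD _ _).
rewrite le_min !ge_min (inf01_le (fun b => sigma (lact p b))).
by rewrite (inf01_le (fun b => sigma (lact q b))) orbT.
Qed.

Lemma sigma_plus_left_ideal :
  fuzzy_left_ideal M sigma ->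
  sr_fuzzy_left_ideal (leftOp_semiring M) (sigma_plus M sigma).
Proof.
move=> sL; split=> [|p q]; first by case: sL => /sigma_plusD.
apply: le_inf01 => [|a]; first exact: gS_inhabited M.
rewrite lact_mul; apply: le_trans (fuzzy_left_ideal_lact _ _ sL).
exact: (inf01_le (fun b => sigma (lact q b))).
Qed.

Lemma sigma_plus_right_ideal :
  fuzzy_right_ideal M sigma ->
  sr_fuzzy_right_ideal (leftOp_semiring M) (sigma_plus M sigma).
Proof.
move=> [/sigma_plusD sD _]; split=> // p q.
apply: le_inf01 => [|a]; first exact: gS_inhabited M.
(* The infimum for p q runs only over the points lact q a of S. *)
rewrite lact_mul; exact: (inf01_le (fun b => sigma (lact p b))).
Qed.

End SigmaPlus.

Theorem proposition3p2 (R : realType) (S G : addSemigroupType)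
    (M : gammaSemiring S G) (sigma : S -> {i01 R}) :
  has_left_unity M -> has_right_unity M ->
  [/\ fuzzy_left_ideal M sigma ->
        sr_fuzzy_left_ideal (leftOp_semiring M) (sigma_plus M sigma),
      fuzzy_right_ideal M sigma ->
        sr_fuzzy_right_ideal (leftOp_semiring M) (sigma_plus M sigma)
    & fuzzy_ideal M sigma ->
        sr_fuzzy_ideal (leftOp_semiring M) (sigma_plus M sigma)].
Proof.
move=> _ _; split; [exact: sigma_plus_left_ideal|exact: sigma_plus_right_ideal|].
by move=> [/sigma_plus_left_ideal ? /sigma_plus_right_ideal].
Qed.
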